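(* Let $X$ be a locally compact space with covering dimension $\dim X\le 1$. Let $\nu$ be a topological measure (respectively, a signed topological measure) on $X$ with $|\nu|(X)<\infty$. Then $\nu$ is a Radon measure (respectively, a signed Radon measure).
   Context: All spaces are Hausdorff. $\mathscr{O}(X),\mathscr{C}(X),\mathscr{K}(X)$ denote the open, closed, compact subsets of $X$; $\sqcup$ is disjoint union. A topological measure on $X$ is a map $\mu:\mathscr{C}(X)\cup\mathscr{O}(X)\to[0,\infty]$, not identically $\infty$, such that: if $A,B,A\sqcup B\in\mathscr{K}(X)\cup\mathscr{O}(X)$ then $\mu(A\sqcup B)=\mu(A)+\mu(B)$; $\mu(U)=\sup\{\mu(K):K\in\mathscr{K}(X),K\subseteq U\}$ for open $U$; $\mu(F)=\inf\{\mu(U):U\in\mathscr{O}(X),F\subseteq U\}$ for closed $F$. A signed topological measure on $X$ is a map $\mu:\mathscr{O}(X)\cup\mathscr{C}(X)\to[-\infty,\infty]$ assuming at most one of $\infty,-\infty$ such that: (STM1) if $A,B,A\sqcup B\in\mathscr{K}(X)\cup\mathscr{O}(X)$ then $\mu(A\sqcup B)=\mu(A)+\mu(B)$; (STM2) $\mu(U)=\lim\{\mu(K):K\in\mathscr{K}(X),K\subseteq U\}$ for open $U$ (limit along the compact subsets of $U$ directed by inclusion); (STM3) $\mu(F)=\lim\{\mu(U):U\in\mathscr{O}(X),F\subseteq U\}$ for closed $F$ (limit along the open supersets directed by reverse inclusion). Total variation: $|\mu|(U)=\sup\{\sum_{i=1}^n|\mu(K_i)|:\bigsqcup_{i=1}^nK_i\subseteq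 U,\ K_i\in\mathscr{K}(X),\ n\in\mathbb{N}\}$ for open $U$; $|\mu|(F)=\inf\{|\mu|(U):F\subseteq U,U\in\mathscr{O}(X)\}$ for closed $F$. A Radon measure is a compact-finite Borel measure that is outer regular on Borel sets and inner compact regular on open sets; a (finite) signed Radon measure is a difference of two finite Radon measures. ''$\nu$ is a (signed) Radon measure'' means that $\nu$ is the restriction to $\mathscr{O}(X)\cup\mathscr{C}(X)$ of a (signed) Radon measure. $\dim X\le1$ means: for every finite open cover $\{U_1,\dots,U_n\}$ of $X$ there is an open cover $\{V_1,\dots,V_n\}$ of $X$ with $V_i\subseteq U_i$ for all $i$ and $V_i\cap V_j\cap V_k=\emptyset$ for any distinct $i,j,k$. *)

(* Defs.v *)
From HB Require Import structures.
From mathcomp Require Export all_boot all_order all_algebra.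
From mathcomp Require Export all_classical all_reals all_analysis.

Set Implicit Arguments.
Unset Strict Implicit.
Unset Printing Implicit Defensive.

Import Order.TTheory GRing.Theory Num.Theory.
Import numFieldNormedType.Exports.

Local Open Scope classical_set_scope.
Local Open Scope ring_scope.
Local Open Scope ereal_scope.

(* Set functions are total functions [set X -> \bar R]; each predicate below
   constrains its argument only on the intended domain (open or closed sets,
   resp. Borel sets), so that the values elsewhere are irrelevant. *)

Definition open_or_closed (X : topologicalType) : set (set X) :=
  [set A | open A \/ closed A].

Definition compact_or_open (X : topologicalType) : set (set X) :=
  [set A | compact A \/ open A].

Definition compacts_in (X : topologicalType) (U : set X) : set (set X) :=
  [set K | compact K /\ K `<=` U].

Definition opens_around (X : topologicalType) (F : set X) : set (set X) :=
  [set U | open U /\ F `<=` U].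

Definition disjoint_additive (R : realType) (X : topologicalType)
    (mu : set X -> \bar R) : Prop :=
  forall A B : set X, compact_or_open A -> compact_or_open B ->
    compact_or_open (A `|` B) -> A `&` B = set0 ->
    mu (A `|` B) = mu A + mu B.

Definition topological_measure (R : realType) (X : topologicalType)
    (mu : set X -> \bar R) : Prop :=
  [/\ forall A, open_or_closed A -> 0 <= mu A,
      exists2 A, open_or_closed A & mu A != +oo,
      disjoint_additive mu,
      forall U, open U -> mu U = ereal_sup [set mu K | K in compacts_in U] &
      forall F, closed F -> mu F = ereal_inf [set mu U | U in opens_around F]].

(* Tail filter of the compact subsets of [U] directed by inclusion. *)
Definition compacts_filter (X : topologicalType) (U : set X) :
    set_system (set X) :=
  filter_from (compacts_in U)
    (fun K => [set K' | compacts_in U K' /\ K `<=` K']).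

(* Tail filter of the open supersets of [F] directed by reverse inclusion. *)
Definition opens_filter (X : topologicalType) (F : set X) :
    set_system (set X) :=
  filter_from (opens_around F)
    (fun U => [set U' | opens_around F U' /\ U' `<=` U]).

Definition signed_topological_measure (R : realType) (X : topologicalType)
    (mu : set X -> \bar R) : Prop :=
  [/\ ~ ((exists2 A, open_or_closed A & mu A = +oo) /\
         (exists2 A, open_or_closed A & mu A = -oo)),
      disjoint_additive mu,
      forall U, open U -> mu K @[K --> compacts_filter U] --> mu U &
      forall F, closed F -> mu U @[U --> opens_filter F] --> mu F].

Definition tm_total_variation_open (R : realType) (X : topologicalType)
    (mu : set X -> \bar R) (U : set X) : \bar R :=
  ereal_sup [set s | exists n (K : 'I_n -> set X),
    [/\ forall i, compact (K i), trivIset setT K, \bigcup_i K i `<=` U &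
        s = \sum_(i < n) `|mu (K i)|]].

(* On clopen sets both clauses agree, by monotonicity of the first one. *)
Definition tm_total_variation (R : realType) (X : topologicalType)
    (mu : set X -> \bar R) (A : set X) : \bar R :=
  if `[< open A >] then tm_total_variation_open mu A
  else ereal_inf [set tm_total_variation_open mu U | U in opens_around A].

Definition borel_set (X : topologicalType) : set (set X) := <<s @open X >>.

(* Library measures live on a [measurableType], which is pointed; this version
   also makes sense on the empty space. [borel_measureP] shows that it agrees
   with the library notion on pointed spaces. *)
Definition borel_measure (R : realType) (X : topologicalType)
    (m : set X -> \bar R) : Prop :=
  [/\ m set0 = 0,
      forall B, borel_set B -> 0 <= m B &
      forall F : (set X)^nat, (forall i, borel_set (F i)) ->
        trivIset setT F ->
        (fun n => \sum_(0 <= i < n) m (F i)) @ \oo --> m (\bigcup_i F i)].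

Definition radon_measure (R : realType) (X : topologicalType)
    (m : set X -> \bar R) : Prop :=
  [/\ borel_measure m,
      forall K, compact K -> m K < +oo,
      forall B, borel_set B -> m B = ereal_inf [set m U | U in opens_around B] &
      forall U, open U -> m U = ereal_sup [set m K | K in compacts_in U]].

Definition signed_radon_measure (R : realType) (X : topologicalType)
    (m : set X -> \bar R) : Prop :=
  exists m1 m2 : set X -> \bar R,
    [/\ radon_measure m1 /\ m1 setT < +oo,
        radon_measure m2 /\ m2 setT < +oo &
        forall B, borel_set B -> m B = m1 B - m2 B].

Definition is_restriction (R : realType) (X : topologicalType)
    (nu m : set X -> \bar R) : Prop :=
  forall A, open_or_closed A -> nu A = m A.

Definition covering_dim_le1 (X : topologicalType) : Prop :=
  forall (n : nat) (U : 'I_n -> set X),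
    (forall i, open (U i)) -> \bigcup_i U i = setT ->
    exists V : 'I_n -> set X,
      [/\ forall i, open (V i),
          \bigcup_i V i = setT,
          forall i, V i `<=` U i &
          forall i j k, i != j -> j != k -> i != k ->
            V i `&` V j `&` V k = set0].

Section borel_measureP.
Variables (R : realType) (X : ptopologicalType).
Local Notation borelType := (g_sigma_algebraType (@open X)).

Section to_measure.
Variable m : set X -> \bar R.
Hypothesis bm : borel_measure m.

Definition measure_of_borel (B : set borelType) : \bar R :=
  if `[< borel_set B >] then m B else 0.

Let mob_borel (B : set borelType) : borel_set B -> measure_of_borel B = m B.
Proof. by move=> bB; rewrite /measure_of_borel asboolT. Qed.

Let mob0 : measure_of_borel set0 = 0.
Proof. by rewrite mob_borel; [case: bm|exact: sigma_algebra0]. Qed.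

Let mob_ge0 B : 0 <= measure_of_borel B.
Proof.
by rewrite /measure_of_borel; case: asboolP => // bB; case: bm => _ /(_ B bB).
Qed.

Let mob_sigma : semi_sigma_additive measure_of_borel.
Proof.
move=> F mF tF mUF; rewrite mob_borel//; case: bm => _ _ /(_ F mF tF).
rewrite (_ : (fun n => \sum_(0 <= i < n) measure_of_borel (F i)) =
  (fun n => \sum_(0 <= i < n) m (F i)))//.
by apply/funext => n; apply: eq_bigr => i _; exact: (mob_borel (mF i)).
Qed.

HB.instance Definition _ :=
  isMeasure.Build _ _ _ measure_of_borel mob0 mob_ge0 mob_sigma.

Lemma measure_of_borelE :
  exists mu : {measure set borelType -> \bar R},
    forall B, borel_set B -> m B = mu B.
Proof. by exists measure_of_borel => B bB; rewrite /= mob_borel. Qed.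

End to_measure.

Lemma borel_measureP (m : set X -> \bar R) :
  borel_measure m <-> exists mu : {measure set borelType -> \bar R},
    forall B, borel_set B -> m B = mu B.
Proof.
split; first exact: measure_of_borelE.
move=> [mu mE]; split.
- by rewrite mE ?measure0//; exact: sigma_algebra0.
- by move=> B bB; rewrite mE.
- move=> F bF tF; rewrite mE; last exact: sigma_algebra_bigcup.
  rewrite (_ : (fun n => \sum_(0 <= i < n) m (F i)) =
    (fun n => \sum_(0 <= i < n) mu (F i))).
    exact: measure_sigma_additive.
  by apply/funext => n; apply: eq_bigr => i _; exact: (mE _ (bF i)).
Qed.

End borel_measureP.

(* Main.v *)
Require Import Defs.
From HB Require Import structures.
From mathcomp Require Import all_boot all_order all_algebra.
From mathcomp Require Import all_classical all_reals all_analysis.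
From mathcomp Require Import ring lra.

(* Write f for nu, which is finite, and p(U) = sup { f(K) : K compact, K <= U }
   on open sets U. The outer measure induced by p is a Radon measure as soon as
   p is subadditive: compactness yields countable subadditivity, and
   superadditivity on disjoint open sets yields Caratheodory measurability.

   The dimension is used only to show that f is modular on compact sets. Given
   compact A1 <= U1 and A2 <= U2, a refinement without triple intersections of
   the cover U1 & U2, U1 \ A2, U2 \ A1, ~(A1 | A2) yields neighbourhoods W1, W2
   of A1, A2 inside U1, U2 for which f(W1 | W2) + f(W1 & W2) = f(W1) + f(W2) is
   a consequence of additivity on disjoint sets; then W1, W2 shrink to A1, A2.

   Modularity and outer regularity imply that f(K) - f(D), for compact D <= K,
   is approximated by f on compact subsets of K \ D, so p is subadditive. Let n
   be obtained from -f as p is from f. Additivity f(U) = f(K) + f(U \ K) gives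
   f = p - n on open sets, and by regularity on closed sets. *)

Set Implicit Arguments.
Unset Strict Implicit.
Unset Printing Implicit Defensive.

Import Order.TTheory GRing.Theory Num.Theory.
Import numFieldNormedType.Exports.

Local Open Scope classical_set_scope.
Local Open Scope ring_scope.
Local Open Scope ereal_scope.

(** * Properness of the filters along which the limits are taken *)

Section filters.
Context {X : topologicalType}.

Lemma compacts_filter_filter (U : set X) : ProperFilter (compacts_filter U).
Proof.
apply: filter_from_proper; last by move=> K cK; exists K; split.
apply: filter_from_filter; first by exists set0; split=> //; exact: compact0.
move=> K L [cK KU] [cL LU]; exists (K `|` L).
  by split; [exact: compactU|rewrite subUset].
by move=> M [cM]; rewrite subUset => -[KM LM].
Qed.

Lemma opens_filter_filter (F : set X) : ProperFilter (opens_filter F).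
Proof.
apply: filter_from_proper; last by move=> U oU; exists U; split.
apply: filter_from_filter; first by exists setT; split=> //; exact: openT.
move=> U V [oU FU] [oV FV]; exists (U `&` V).
  by split; [exact: openI|rewrite subsetI].
by move=> W [oW]; rewrite subsetI => -[WU WV].
Qed.

End filters.

#[global] Hint Extern 0 (ProperFilter (compacts_filter _)) =>
  solve [exact: compacts_filter_filter] : typeclass_instances.
#[global] Hint Extern 0 (ProperFilter (opens_filter _)) =>
  solve [exact: opens_filter_filter] : typeclass_instances.

(** * Separation and splitting of compact sets *)

Section locally_compact_hausdorff.
Context {X : topologicalType}.
Hypotheses (hausX : hausdorff_space X) (lcX : locally_compact [set: X]).

Lemma compact_setD (K U : set X) : compact K -> open U -> compact (K `\` U).
Proof.
move=> cK oU; apply: (subclosed_compact _ cK); last by move=> x [].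
by apply: closedI; [exact: compact_closed|exact: open_closedC].
Qed.

(* Near-covering of [K] along the compact subsets of [U]: the interiors of
   these exhaust [U]. *)
Lemma compact_nbhs (K U : set X) : compact K -> open U -> K `<=` U ->
  exists C, compacts_in U C /\ K `<=` C°.
Proof.
move=> cK oU KU; suff [C cC KC] : compacts_filter U (fun C => K `<=` C°).
  by exists C; split=> //; apply: KC; split.
move/compact_near_coveringP : cK.
move=> /(_ _ (compacts_filter U) (fun C => C°) _); apply=> x Kx.
have [B] := @lcX x I; rewrite withinET => Bx [cB clB].
have UBx : nbhs x (U `&` B).
  by apply: filterI => //; apply: open_nbhs_nbhs; split=> //; exact: KU.
(* Regularity of the compact [B] at [x] gives [W] with closure in [U & B], hence compact. *)
have [W Wx WUB] := compact_regular hausX cB Bx UBx.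
have cW : compacts_in U (closure W).
  split; last by move=> y /WUB[].
  by apply: (subclosed_compact _ cB); [exact: closed_closure|move=> y /WUB[]].
exists (W°, [set C | compacts_in U C /\ closure W `<=` C]).
  split; first exact: nbhs_interior.
  by exists (closure W).
move=> [y C] [/= Wy [cC WC]]; apply: filterS Wy.
exact: (subset_trans (@subset_closure _ W)).
Qed.

Lemma disjoint_compacts_separated (K L : set X) :
  compact K -> compact L -> K `&` L = set0 ->
  exists G H, [/\ open G, open H, K `<=` G, L `<=` H & G `&` H = set0].
Proof.
move=> cK cL /disjoints_subset KL.
have [|C [[cC CL] KC]] := compact_nbhs cK _ KL.
  by apply: closed_openC; exact: compact_closed.
exists C°, (~` C); split=> //.
- exact: open_interior.
- by apply: closed_openC; exact: compact_closed.
- by move=> x Lx /CL.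
- by apply/disjoints_subset; rewrite setCK; exact: interior_subset.
Qed.

(** A compact neighbourhood [C] of [K \ V] inside [U] cuts [K] into [K & C] and [K \ C°]. The pieces
    may overlap along the boundary of [C], so adding their values will require modularity. *)
Lemma compact_setU_split (K U V : set X) : compact K -> open U -> open V ->
  K `<=` U `|` V -> exists K1 K2,
    [/\ compacts_in U K1, compacts_in V K2 & K = K1 `|` K2].
Proof.
move=> cK oU oV KUV.
have cKV : compact (K `\` V) by exact: compact_setD.
have [|C [[cC CU] KC]] := compact_nbhs cKV oU.
  by move=> x [/KUV[]].
have clC := compact_closed hausX cC.
exists (K `&` C), (K `\` C°); split.
- split; last by move=> x [_ /CU].
  by apply: compact_closedI.
- split; first by apply: compact_setD => //; exact: open_interior.
  move=> x [Kx nCx]; apply: contrapT => nVx; exact/nCx/KC.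
- apply/seteqP; split=> [x Kx|x [[]|[]]//].
  have [Cx|nCx] := pselect (C° x); last by right.
  by left; split=> //; exact: interior_subset.
Qed.

End locally_compact_hausdorff.

(** * The Radon measure induced by a content on compact sets *)

Section compact_content.
Context {R : realType} {X : topologicalType}.
Implicit Types (f : set X -> R) (U V : set X).

(** The values of [f] may be negative; the empty set keeps the supremum nonnegative when
    [f set0 = 0]. *)
Definition inner_content f U : \bar R :=
  ereal_sup [set (f K)%:E | K in compacts_in U].

Definition outer_content f A : \bar R :=
  ereal_inf [set inner_content f U | U in opens_around A].

Lemma le_inner_content f : {homo inner_content f : U V / U `<=` V >-> U <= V}.
Proof.
move=> U V UV; apply: ereal_sup_le => _ [K [cK KU] <-]; exists K => //.
by split=> //; exact: subset_trans UV.
Qed.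

Lemma le_outer_content f : {homo outer_content f : U V / U `<=` V >-> U <= V}.
Proof.
move=> A B AB; apply: ereal_inf_le_tmp => _ [U [oU BU] <-]; exists U => //.
by split=> //; exact: subset_trans BU.
Qed.

Lemma outer_content_open f U : open U -> outer_content f U = inner_content f U.
Proof.
move=> oU; apply/eqP; rewrite eq_le; apply/andP; split.
  by apply: ereal_inf_lbound; exists U => //; split.
by apply: le_ereal_inf_tmp => _ [V [oV UV] <-]; exact: le_inner_content.
Qed.

Lemma outer_content_compact_ge f K : compact K -> (f K)%:E <= outer_content f K.
Proof.
move=> cK; apply: le_ereal_inf_tmp => _ [U [oU KU] <-].
by apply: ereal_sup_ubound; exists K.
Qed.

(** As [f] need not be monotone, [outer_content f K] may exceed [f K]; the suprema agree because [f
    K <= outer_content f K <= inner_content f U] for compact [K] in [U]. *)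
Lemma inner_content_regular f U : open U ->
  inner_content f U = ereal_sup [set outer_content f K | K in compacts_in U].
Proof.
move=> oU; apply/eqP; rewrite eq_le; apply/andP; split; apply: ge_ereal_sup.
  move=> _ [K [cK KU] <-]; apply: le_ereal_sup_tmp.
  by exists (outer_content f K); [exists K|exact: outer_content_compact_ge].
by move=> _ [K [cK KU] <-]; apply: ereal_inf_lbound; exists U.
Qed.

Section radon.
Hypotheses (hausX : hausdorff_space X) (lcX : locally_compact [set: X]).
Variable f : set X -> R.
Hypothesis f0 : f set0 = 0%R.
Hypothesis fU : forall K L, compact K -> compact L -> K `&` L = set0 ->
  f (K `|` L) = (f K + f L)%R.
Hypothesis inner_contentU : forall U V, open U -> open V ->
  inner_content f (U `|` V) <= inner_content f U + inner_content f V.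
Hypothesis inner_content_lty : inner_content f setT < +oo.

Lemma inner_content_ge0 U : 0 <= inner_content f U.
Proof.
apply: ereal_sup_ubound; exists set0; last by rewrite f0.
by split=> //; exact: compact0.
Qed.

Lemma inner_content_fin_num U : inner_content f U \is a fin_num.
Proof.
rewrite ge0_fin_numE ?inner_content_ge0//.
exact: le_lt_trans (le_inner_content _ (@subsetT _ U)) inner_content_lty.
Qed.

Lemma inner_content0 : inner_content f set0 = 0.
Proof.
apply/eqP; rewrite eq_le inner_content_ge0 andbT; apply: ge_ereal_sup.
by move=> _ [K [_ +] <-]; rewrite subset0 => ->; rewrite f0.
Qed.

Lemma outer_content_ge0 A : 0 <= outer_content f A.
Proof.
by apply: le_ereal_inf_tmp => _ [U _ <-]; exact: inner_content_ge0.
Qed.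

Lemma outer_content_fin_num A : outer_content f A \is a fin_num.
Proof.
rewrite ge0_fin_numE ?outer_content_ge0//.
apply: le_lt_trans (le_outer_content _ (@subsetT _ A)) _.
by rewrite outer_content_open//; exact: openT.
Qed.

Lemma inner_content_superadditive U V : U `&` V = set0 ->
  inner_content f U + inner_content f V <= inner_content f (U `|` V).
Proof.
move=> UV; rewrite -leeBrDr ?inner_content_fin_num//.
apply: ge_ereal_sup => _ [K [cK KU] <-].
rewrite leeBrDr ?inner_content_fin_num// addeC.
rewrite -leeBrDr//; apply: ge_ereal_sup => _ [L [cL LV] <-].
rewrite leeBrDr// -EFinD addrC -fU//; last first.
  by rewrite -subset0 -UV; exact: setISS.
apply: ereal_sup_ubound; exists (K `|` L) => //.
by split; [exact: compactU|exact: setUSS].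
Qed.

Lemma inner_content_bigcup (U : (set X)^nat) : (forall i, open (U i)) ->
  inner_content f (\bigcup_i U i) <= \sum_(i <oo) inner_content f (U i).
Proof.
move=> oU; apply: ge_ereal_sup => _ [K [cK KU] <-].
(* Near-covering along [\oo]: around a point of [U i], the neighbourhood [U i] serves for all
   [n > i]. *)
have [n _ KUn] : \oo (fun n => K `<=` \bigcup_(i < n) U i).
  move/compact_near_coveringP : cK.
  move=> /(_ _ \oo (fun n => \bigcup_(i < n) U i) _); apply=> x /KU[i _ Uix].
  exists (U i, [set n | (i < n)%N]).
    split=> /=; first by apply: open_nbhs_nbhs; split=> //; exact: oU.
    exact: nbhs_infty_gt.
  by move=> [y n] [/= Uiy ni]; exists i.
have {}KUn := KUn n (leqnn n).
apply: (@le_trans _ _ (inner_content f (\bigcup_(i < n) U i))).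
  by apply: ereal_sup_ubound; exists K.
apply: (@le_trans _ _ (\sum_(0 <= i < n) inner_content f (U i))); last first.
  by apply: nneseries_lim_ge => i _ _; exact: inner_content_ge0.
rewrite big_mkord bigcup_mkord {K cK KU KUn}.
elim: n => [|n IH]; first by rewrite !big_ord0 inner_content0.
rewrite !big_ord_recr/=; apply: (le_trans (inner_contentU _ _)) => //.
  by rewrite -bigcup_mkord; exact: bigcup_open.
exact: leeD2r.
Qed.

Lemma outer_content0 : outer_content f set0 = 0.
Proof. by rewrite outer_content_open ?inner_content0//; exact: open0. Qed.

Lemma outer_content_sigma_subadditive : sigma_subadditive (outer_content f).
Proof.
move=> A; apply/lee_addgt0Pr => e e0.
rewrite (le_trans _ (epsilon_trick _ _ (ltW e0)))//; last first.
  by move=> n; exact: outer_content_ge0.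
have /choice[U AU] : forall n, exists U, opens_around (A n) U /\
    inner_content f U <= outer_content f (A n) + (e / (2 ^ n.+1)%:R)%:E.
  move=> n; have en : (0 < e / (2 ^ n.+1)%:R)%R.
    by rewrite divr_gt0// ltr0n expn_gt0.
  have [_ [U AU <-] /ltW ?] :=
    lb_ereal_inf_adherent en (outer_content_fin_num (A n)).
  by exists U.
apply: (@le_trans _ _ (\sum_(n <oo) inner_content f (U n))); last first.
  apply: lee_nneseries => [n _ _|n _]; first exact: inner_content_ge0.
  by have [] := AU n.
apply: le_trans (inner_content_bigcup _); last by move=> i; have [[]] := AU i.
apply: ereal_inf_lbound; exists (\bigcup_n U n) => //; split.
  by apply: bigcup_open => n _; have [[]] := AU n.
by apply: subset_bigcup => n _; have [[]] := AU n.
Qed.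

HB.instance Definition _ := isOuterMeasure.Build R X (outer_content f)
  outer_content0 outer_content_ge0 (@le_outer_content f)
  outer_content_sigma_subadditive.

Let mu : {outer_measure set X -> \bar R} := outer_content f.

Lemma open_caratheodory U : open U -> (outer_content f).-caratheodory U.
Proof.
move=> oU; apply: (@le_caratheodory_measurable _ _ mu) => A /=.
apply: le_ereal_inf_tmp => _ [V [oV AV] <-].
apply: (@le_trans _ _ (inner_content f (V `&` U) + outer_content f (V `\` U))).
  apply: leeD; last by apply: le_outer_content; exact: setSD.
  by rewrite -outer_content_open; [apply: le_outer_content; exact: setSI|
    exact: openI].
rewrite -leeBrDr ?outer_content_fin_num//.
apply: ge_ereal_sup => _ [K [cK KVU] <-]; rewrite leeBrDr ?outer_content_fin_num//.
(* The sets [C°] and [V & ~C] are open and disjoint; the first contains [K] and the second contains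
   [V \ U], so superadditivity applies. *)
have [C [[cC CVU] KC]] := compact_nbhs hausX lcX cK (openI oV oU) KVU.
have oC : open (~` C) by apply: closed_openC; exact: compact_closed.
apply: (@le_trans _ _ (inner_content f C° + inner_content f (V `&` ~` C))).
  apply: leeD; first by apply: ereal_sup_ubound; exists K.
  apply: ereal_inf_lbound; exists (V `&` ~` C) => //; split; first exact: openI.
  by move=> x [Vx nUx]; split=> // /CVU[].
apply: le_trans (inner_content_superadditive _) _.
  apply/disjoints_subset => x Cx [_]; apply; exact: interior_subset.
by apply: le_inner_content => x [/interior_subset/CVU[]|[]].
Qed.

Lemma borel_caratheodory : @borel_set X `<=` (outer_content f).-caratheodory.
Proof.
apply: smallest_sub; last by move=> U; exact: open_caratheodory.
split; first exact: (caratheodory_measurable_set0 mu).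
- by move=> A mA; rewrite setTD; exact: (caratheodory_measurable_setC (mu := mu)).
- by move=> A mA; exact: (caratheodory_measurable_bigcup (mu := mu)).
Qed.

Lemma outer_content_borel_measure : borel_measure (outer_content f).
Proof.
split; [exact: outer_content0|by move=> B _; exact: outer_content_ge0|].
move=> F mF tF.
have -> : outer_content f (\bigcup_i F i) = \sum_(i <oo) outer_content f (F i).
  apply/eqP; rewrite eq_le outer_content_sigma_subadditive/=.
  (* With the union itself as test set, the complementary term is the outer measure of the empty
     set. *)
  have := caratheodory_lime_le (mu := mu)
    (fun i => borel_caratheodory (mF i)) tF (\bigcup_i F i).
  rewrite setICr outer_measure0 adde0; apply: le_trans.
  rewrite le_eqVlt; apply/orP; left; apply/eqP.
  apply: eq_eseriesr => i _; congr (outer_content f _).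
  by rewrite setIC; apply/esym/setIidPl; exact: bigcup_sup.
by apply: is_cvg_nneseries => i _ _; exact: outer_content_ge0.
Qed.

Lemma outer_content_radon : radon_measure (outer_content f).
Proof.
split.
- exact: outer_content_borel_measure.
- by move=> K _; rewrite -ge0_fin_numE ?outer_content_ge0 ?outer_content_fin_num.
- move=> B _; rewrite {1}/outer_content; congr ereal_inf.
  by apply: eq_imagel => U [oU _]; rewrite outer_content_open.
- by move=> U oU; rewrite -inner_content_regular// outer_content_open.
Qed.

End radon.
End compact_content.

(** * Bounded real-valued signed topological measures *)

Section bounded_stm.
Context {R : realType} {X : topologicalType}.
Implicit Types (f : set X -> R).
Local Close Scope ereal_scope.

(** This class is closed under negation, so that what is proved for [p] applies to [n] as well. *)
Definition bounded_stm f : Prop :=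
  [/\ forall A B, compact_or_open A -> compact_or_open B ->
        compact_or_open (A `|` B) -> A `&` B = set0 ->
        f (A `|` B) = f A + f B,
      forall U, open U -> f K @[K --> compacts_filter U] --> f U,
      forall F, closed F -> f U @[U --> opens_filter F] --> f F &
      exists M, forall K, compact K -> `|f K| <= M].

Lemma bounded_stmN f : bounded_stm f -> bounded_stm (\- f).
Proof.
case=> fD fI fO [M fM]; split.
- by move=> A B cA cB cAB AB; rewrite /= fD// opprD.
- by move=> U oU; apply: cvgN; exact: fI.
- by move=> F cF; apply: cvgN; exact: fO.
- by exists M => K cK; rewrite normrN fM.
Qed.

Section additivity.
Variable f : set X -> R.
Hypothesis stm_f : bounded_stm f.

Lemma stmU A B : compact_or_open A -> compact_or_open B ->
  compact_or_open (A `|` B) -> A `&` B = set0 -> f (A `|` B) = f A + f B.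
Proof. by have [fD _ _ _] := stm_f; exact: fD. Qed.

Lemma stm0 : f set0 = 0.
Proof.
have c0 : @compact_or_open X set0 by left; exact: compact0.
have := @stmU set0 set0 c0 c0; rewrite setU0 set0I => /(_ c0 erefl).
by move=> /eqP; rewrite -subr_eq0 opprD addrA subrr sub0r oppr_eq0 => /eqP.
Qed.

Lemma stm_compactU K L : compact K -> compact L -> K `&` L = set0 ->
  f (K `|` L) = f K + f L.
Proof. by move=> cK cL; apply: stmU; left => //; exact: compactU. Qed.

Lemma stm_open_approx U (e : R) : open U -> 0 < e ->
  exists2 K, compacts_in U K & `|f U - f K| < e.
Proof.
move=> oU e0; have [_ /(_ _ oU)/cvgrPdist_lt/(_ _ e0)[K KU KP] _ _] := stm_f.
by exists K => //; apply: KP; split.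
Qed.

Lemma stm_closed_approx F (e : R) : closed F -> 0 < e ->
  exists2 U, opens_around F U &
    forall V, open V -> F `<=` V -> V `<=` U -> `|f F - f V| < e.
Proof.
move=> cF e0; have [_ _ /(_ _ cF)/cvgrPdist_lt/(_ _ e0)[U FU UP] _] := stm_f.
by exists U => // V oV FV VU; apply: UP.
Qed.

End additivity.

(** * Modularity and subadditivity in dimension at most one *)

Section modularity.
Hypotheses (hausX : hausdorff_space X) (lcX : locally_compact [set: X]).
Hypothesis dimX : covering_dim_le1 X.

(** The cover sorts points by membership in [A1] and [A2]: both, only one, or neither. The two empty
    triple intersections make [Q & N] disjoint from [P | T]. *)
Lemma dim_le1_refinement (U1 U2 A1 A2 : set X) : open U1 -> open U2 ->
    closed A1 -> closed A2 ->
  A1 `<=` U1 -> A2 `<=` U2 -> exists T Q P N,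
    [/\ [/\ open T, open Q, open P & open N],
        [/\ T `<=` U1 `&` U2, Q `<=` U1 `\` A2, P `<=` U2 `\` A1 &
            N `<=` ~` (A1 `|` A2)],
        forall x, [\/ T x, Q x, P x | N x],
        Q `&` N `&` P = set0 & Q `&` N `&` T = set0].
Proof.
move=> oU1 oU2 cA1 cA2 AU1 AU2.
pose U (i : 'I_4) := nth set0
  [:: U1 `&` U2; U1 `\` A2; U2 `\` A1; ~` (A1 `|` A2)] i.
pose i0 := @Ordinal 4 0 isT. pose i1 := @Ordinal 4 1 isT.
pose i2 := @Ordinal 4 2 isT. pose i3 := @Ordinal 4 3 isT.
have oU i : open (U i).
  case: i => -[|[|[|[|//]]]] ?; rewrite /U/=.
  - exact: openI.
  - by apply: openI => //; exact: closed_openC.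
  - by apply: openI => //; exact: closed_openC.
  - by apply: closed_openC; exact: closedU.
have cU : \bigcup_i U i = setT.
  apply/seteqP; split=> // x _.
  have [A1x|nA1x] := pselect (A1 x); have [A2x|nA2x] := pselect (A2 x).
  - by exists i0 => //; split; [exact: AU1|exact: AU2].
  - by exists i1 => //; split => //; exact: AU1.
  - by exists i2 => //; split => //; exact: AU2.
  - by exists i3 => //; case.
have [V [oV cV VU V3]] := dimX oU cU.
exists (V i0), (V i1), (V i2), (V i3); split.
- by split.
- by split; [exact: (VU i0)|exact: (VU i1)|exact: (VU i2)|exact: (VU i3)].
- move=> x; have [i _] : (\bigcup_i V i) x by rewrite cV.
  case: i => -[|[|[|[|//]]]] p; rewrite (bool_irrelevance p isT) => ?.
  + by constructor 1.
  + by constructor 2.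
  + by constructor 3.
  + by constructor 4.
- exact: V3.
- exact: V3.
Qed.

Variable f : set X -> R.
Hypothesis stm_f : bounded_stm f.

(* With W1 = Q | T and W2 = P | T, both W1 \ (W1 & W2) and (W1 | W2) \ W2 are
   the disjoint union of the open set Q & N and the compact set
   E = X \ (P | T | N), because triple intersections are empty. *)
Lemma stm_modular_nbhs (U1 U2 A1 A2 C : set X) : open U1 -> open U2 ->
    closed A1 -> closed A2 ->
  A1 `<=` U1 -> A2 `<=` U2 -> compact C -> U1 `<=` C -> exists W1 W2,
  [/\ [/\ open W1, A1 `<=` W1 & W1 `<=` U1],
      [/\ open W2, A2 `<=` W2 & W2 `<=` U2] &
      f (W1 `|` W2) + f (W1 `&` W2) = f W1 + f W2].
Proof.
move=> oU1 oU2 cA1 cA2 AU1 AU2 cC UC.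
have [T [Q [P [N [[oT oQ oP oN] [TU QU PU NU] cov QNP QNT]]]]] :=
  dim_le1_refinement oU1 oU2 cA1 cA2 AU1 AU2.
pose E := ~` (P `|` T `|` N).
have EQ : E `<=` Q by move=> x Ex; have [] := cov x => // ?; exfalso; apply: Ex;
  [left; right|left; left|right].
(* [E] is closed and lies in [Q], hence in [U1] and in the compact [C]. *)
have cE : compact E.
  apply: (subclosed_compact _ cC); last by move=> x /EQ/QU[/UC].
  by apply: open_closedC; apply: openU => //; exact: openU.
have fWE W : open W -> open (W `|` Q `&` N `|` E) -> W `<=` P `|` T ->
    f (W `|` Q `&` N `|` E) = f W + f (Q `&` N) + f E.
  move=> oW oWE WPT; have oQN : open (Q `&` N) by exact: openI.
  rewrite !(stmU stm_f)//; try by [left|right|right; exact: openU].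
  - apply/disjoints_subset => x Wx QNx; have [Px|Tx] := WPT x Wx.
      by have : (Q `&` N `&` P) x by []; rewrite QNP.
    by have : (Q `&` N `&` T) x by []; rewrite QNT.
  - apply/disjoints_subset => x WQNx; apply; case: WQNx => [/WPT ?|[_ Ox]].
      by left.
    by right.
have WU : P `|` T `|` Q `&` N `|` E = Q `|` T `|` (P `|` T).
  apply/seteqP; split=> x.
    by move=> [[[?|?]|[? _]]|/EQ ?]; [right; left|right; right|left; left|
      left; left].
  move=> [[Qx|?]|?]; [|by left; left; right|by left; left].
  have [?|nE] := pselect (E x); first by right.
  by left; move/contrapT : nE => [|?]; [left|right].
have WI : (Q `|` T) `&` (P `|` T) `|` Q `&` N `|` E = Q `|` T.
  apply/seteqP; split=> x.
    by move=> [[[? _]|[? _]]|/EQ ?]; [|left|left].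
  move=> [Qx|?]; last by left; left; split; right.
  have [?|nE] := pselect (E x); first by right.
  by left; move/contrapT : nE => [?|?]; [left; split=> //; left|right].
have oW1 : open (Q `|` T) by exact: openU.
have oW2 : open (P `|` T) by exact: openU.
exists (Q `|` T), (P `|` T); split.
- split=> //; last by move=> x [/QU[]|/TU[]].
  move=> x A1x; have [?|?|/PU[]//|/NU[]] := cov x; [by right|by left|by left].
- split=> //; last by move=> x [/PU[]|/TU[]].
  move=> x A2x; have [?|/QU[]//|?|/NU[]] := cov x; [by right|by left|by right].
- have f1 : f (Q `|` T `|` (P `|` T)) = f (P `|` T) + f (Q `&` N) + f E.
    by rewrite -WU fWE// WU; exact: openU.
  have f2 : f (Q `|` T) = f ((Q `|` T) `&` (P `|` T)) + f (Q `&` N) + f E.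
    by rewrite -{1}WI fWE ?WI//; exact: openI.
  by rewrite f1 [f (Q `|` T)]f2; ring.
Qed.

Lemma stm_modular (K L : set X) : compact K -> compact L ->
  f (K `|` L) + f (K `&` L) = f K + f L.
Proof.
move=> cK cL.
have clK := compact_closed hausX cK; have clL := compact_closed hausX cL.
apply/eqP; rewrite -subr_eq0 -normr_eq0 eq_le normr_ge0 andbT.
apply/ler_addgt0Pr => e e0; rewrite add0r.
(* One quarter of [e] for each of the values at [K], [L], [K | L] and [K & L]. *)
have e4 : 0 < e / 4 by rewrite divr_gt0.
have [UK [oUK KUK] fK] := stm_closed_approx stm_f clK e4.
have [UL [oUL LUL] fL] := stm_closed_approx stm_f clL e4.
have [UU [oUU KLU] fU] := stm_closed_approx stm_f (closedU clK clL) e4.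
have [UI [oUI KLI] fI] := stm_closed_approx stm_f (closedI clK clL) e4.
(* [W1] and [W2] must meet only inside [UI]. Separating [K \ UI] from [L] and requiring
   [W1 <= G | UI] and [W2 <= H] forces this. *)
have [G [H [oG oH KG LH GH]]] : exists G H, [/\ open G, open H,
    K `\` UI `<=` G, L `<=` H & G `&` H = set0].
  apply: disjoint_compacts_separated => //; first exact: compact_setD.
  by apply/disjoints_subset => x [Kx nUIx] Lx; apply: nUIx; exact: KLI.
(* Passing to [C°] makes the first open set relatively compact, as [stm_modular_nbhs] requires. *)
have [|x Kx|C [[cC CU] KC]] :=
  @compact_nbhs _ hausX lcX K (UK `&` UU `&` (G `|` UI)) cK.
- by apply: openI; [exact: openI|exact: openU].
- split; first by split; [exact: KUK|by apply: KLU; left].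
  by have [?|?] := pselect (UI x); [right|left; exact: KG].
have [||||W1 [W2 [[oW1 KW1 WC1] [oW2 LW2 WU2] Wmod]]] :=
    @stm_modular_nbhs C° (UL `&` UU `&` H) K L C (open_interior _) _ clK clL KC.
- by apply: openI => //; exact: openI.
- by move=> x Lx; split; [split; [exact: LUL|by apply: KLU; right]|exact: LH].
- exact: cC.
- exact: interior_subset.
have {}WC1 : W1 `<=` UK `&` UU `&` (G `|` UI).
  by move=> x /WC1/interior_subset/CU.
have := fK _ oW1 KW1 (fun x Wx => (WC1 x Wx).1.1).
have := fL _ oW2 LW2 (fun x Wx => (WU2 x Wx).1.1).
have := fU _ (openU oW1 oW2) (setUSS KW1 LW2).
have := fI _ (openI oW1 oW2) (setISS KW1 LW2).
have WI : W1 `&` W2 `<=` UI.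
  move=> x [/WC1[_ [Gx|//]] /WU2[_ Hx]].
  by have : (G `&` H) x by []; rewrite GH.
have WU : W1 `|` W2 `<=` UU by move=> x [/WC1[[]]|/WU2[[]]].
move=> /(_ WI) + /(_ WU); rewrite !ltr_norml => ? ? ? ?.
by rewrite ler_norml; apply/andP; split; lra.
Qed.

(** An open neighbourhood of [C] inside [W] whose value is close to [f C] also contains [D]; it
    carries the estimate from open sets over to the compact [C]. *)
Lemma stm_compact_near (D W : set X) (e : R) : closed D ->
    (forall V, open V -> D `<=` V -> V `<=` W -> `|f D - f V| < e) -> 0 < e ->
    open W ->
  forall C, compact C -> D `<=` C -> C `<=` W -> `|f D - f C| < e + e.
Proof.
move=> cD DW e0 oW C cC DC CW.
have [U [oU CU] fC] := stm_closed_approx stm_f (compact_closed hausX cC) e0.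
have oV := openI oU oW.
have CV : C `<=` U `&` W by move=> x Cx; split; [exact: CU|exact: CW].
have := fC _ oV CV (@subIsetl _ _ _).
have := DW _ oV (subset_trans DC CV) (@subIsetr _ _ _).
rewrite !ltr_norml => ? ?; apply/andP; split; lra.
Qed.

(** Take [L = K \ C°] for a compact neighbourhood [C] of [D] in a small [W]. With [B = K & C \ C°],
    modularity reads [f K + f B = f L + f (K & C)]. Here [f (K & C)] is near [f D], and [f B] is
    near 0 because [f (B | D) = f B + f D] is near [f D]. *)
Lemma stm_setD_approx (K D : set X) (e : R) : compact K -> compact D ->
  D `<=` K -> 0 < e ->
  exists2 L, compacts_in (K `\` D) L & `|f K - f D - f L| < e.
Proof.
move=> cK cD DK e0; have clD := compact_closed hausX cD.
have e4 : 0 < e / 4 by rewrite divr_gt0.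
have [W [oW DW] fD] := stm_closed_approx stm_f clD e4.
have fC := stm_compact_near clD fD e4 oW.
have [C [[cC CW] DC]] := compact_nbhs hausX lcX cD oW DW.
have clC := compact_closed hausX cC.
have DsubC := subset_trans DC (@interior_subset _ C).
have cKC : compact (K `&` C) by exact: compact_closedI.
have cKC' : compact (K `\` C°) by apply: compact_setD => //; exact: open_interior.
have cB : compact (K `&` C `\` C°) by apply: compact_setD => //; exact: open_interior.
exists (K `\` C°).
  by split=> // x [Kx nCx]; split=> // Dx; exact/nCx/DC.
have := stm_modular cKC' cKC.
have -> : K `\` C° `|` K `&` C = K.
  apply/seteqP; split=> [x [[]|[]]//|x Kx].
  have [Cx|nCx] := pselect (C° x); last by left.
  by right; split=> //; exact: interior_subset.
have -> : (K `\` C°) `&` (K `&` C) = K `&` C `\` C°.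
  by apply/seteqP; split=> x; rewrite /= => ?; tauto.
have := fC (K `&` C) cKC.
have := fC (K `&` C `\` C° `|` D) (compactU cB cD) (@subsetUr _ _ _).
rewrite (stm_compactU stm_f cB cD); last first.
  by apply/disjoints_subset => x [_ nCx] /DC.
move=> /(_ _) h1 /(_ _ _) h2 h3.
have {}h1 : `|f D - (f (K `&` C `\` C°) + f D)| < e / 4 + e / 4.
  by apply: h1 => x [[[_ /CW]]|/DW].
have {}h2 : `|f D - f (K `&` C)| < e / 4 + e / 4.
  by apply: h2 => [x Dx|x [_ /CW]//]; split; [exact: DK|exact: DsubC].
by move: h1 h2; rewrite !ltr_norml => ? ?; apply/andP; split; lra.
Qed.

Local Open Scope ereal_scope.

(** Split [K] as [K1 | K2] with overlap [D = K1 & K2]. By modularity [f K = f K1 - f D + f K2], and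
    [f K1 - f D] is near [f L] for a compact [L] in [K1 \ D], hence in [U]. *)
Lemma stm_inner_contentU (U V : set X) : open U -> open V ->
  inner_content f (U `|` V) <= inner_content f U + inner_content f V.
Proof.
move=> oU oV; apply: ge_ereal_sup => _ [K [cK KUV] <-].
apply/lee_addgt0Pr => e e0.
have [K1 [K2 [[cK1 K1U] [cK2 K2V] KE]]] :=
  compact_setU_split hausX lcX cK oU oV KUV.
have cD : compact (K1 `&` K2).
  by apply: compact_closedI => //; exact: compact_closed.
have [L [cL LK] fL] := stm_setD_approx cK1 cD (@subIsetl _ _ _) e0.
apply: (@le_trans _ _ ((f L)%:E + (f K2)%:E + e%:E)).
  have := stm_modular cK1 cK2; rewrite -KE -!EFinD lee_fin => ?.
  by move: fL; rewrite ltr_norml => ?; lra.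
apply: leeD => //; apply: leeD; apply: ereal_sup_ubound; last by exists K2.
by exists L => //; split=> // x /LK[/K1U].
Qed.

Lemma stm_inner_content_lty : inner_content f setT < +oo.
Proof.
have [_ _ _ [M fM]] := stm_f; apply: (@le_lt_trans _ _ M%:E); last exact: ltry.
apply: ge_ereal_sup => _ [K [cK _] <-]; rewrite lee_fin.
exact: le_trans (ler_norm _) (fM _ cK).
Qed.

Lemma stm_outer_content_radon : radon_measure (outer_content f).
Proof.
apply: outer_content_radon => //; first exact: stm0.
- exact: stm_compactU.
- exact: stm_inner_contentU.
- exact: stm_inner_content_lty.
Qed.

Lemma stm_outer_content_fin_num A : outer_content f A \is a fin_num.
Proof.
apply: outer_content_fin_num; [exact: stm0|exact: stm_inner_content_lty].
Qed.

End modularity.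
End bounded_stm.

(** * Jordan decomposition on open and closed sets *)

Section jordan.
Context {R : realType} {X : topologicalType}.
Implicit Types (f : set X -> R).

(** Compact subsets of [V] approximate [f V] and also lie in [U]; [f] itself need not be
    monotone. *)
Lemma stm_open_ge f U V : bounded_stm f -> open U -> open V -> V `<=` U ->
  (f V)%:E <= inner_content f U.
Proof.
move=> stm_f oU oV VU; apply/lee_addgt0Pr => e e0.
have [K [cK KV] fK] := stm_open_approx stm_f oV e0.
apply: (@le_trans _ _ ((f K)%:E + e%:E)).
  by rewrite -EFinD lee_fin; move: fK; rewrite ltr_norml => ?; lra.
apply: leeD => //; apply: ereal_sup_ubound; exists K => //.
by split=> //; exact: subset_trans VU.
Qed.

(** For compact [K] in [U], [f K = f U - f (U \ K)], and [- f (U \ K)] is at most the content of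
    [\- f] on [U] because [U \ K] is open. *)
Lemma stm_inner_content_le f U : hausdorff_space X -> bounded_stm f -> open U ->
  inner_content f U <= (f U)%:E + inner_content (\- f)%R U.
Proof.
move=> hausX stm_f oU; apply: ge_ereal_sup => _ [K [cK KU] <-].
have oUK : open (U `\` K).
  by apply: openI => //; apply: closed_openC; exact: compact_closed.
have fU : f U = (f K + f (U `\` K))%R.
  rewrite -(stmU stm_f) ?setDUK//; [by left|by right|by right|].
  by rewrite setDIK.
have := stm_open_ge (bounded_stmN stm_f) oU oUK (@subDsetl _ _ _).
move=> /(leeD2l (f U)%:E); apply: le_trans.
by rewrite -EFinD lee_fin fU /=; lra.
Qed.

Lemma stm_jordan_open f U : hausdorff_space X -> bounded_stm f -> open U ->
  (f U)%:E = inner_content f U - inner_content (\- f)%R U.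
Proof.
move=> hausX stm_f oU; have stm_Nf := bounded_stmN stm_f.
have fin g : bounded_stm g -> inner_content g U \is a fin_num.
  move=> stm_g; apply: inner_content_fin_num; first exact: stm0.
  exact: stm_inner_content_lty.
apply/eqP; rewrite eq_le leeBrDr ?fin// leeBlDr ?fin//.
rewrite (stm_inner_content_le hausX stm_f oU) andbT.
(* The reverse inequality is the same bound for [\- f]. *)
have := stm_inner_content_le hausX stm_Nf oU.
have -> : (\- (\- f))%R = f by apply/funext => A /=; rewrite opprK.
by move=> /(leeD2l (f U)%:E); rewrite addeA -EFinD subrr add0e.
Qed.

Lemma stm_jordan_closed f F : hausdorff_space X -> bounded_stm f -> closed F ->
  (f F)%:E = outer_content f F - outer_content (\- f)%R F.
Proof.
move=> hausX stm_f cF; have stm_Nf := bounded_stmN stm_f.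
have near g (e : R) : bounded_stm g -> (0 < e)%R -> exists2 U, opens_around F U &
    forall V, open V -> F `<=` V -> V `<=` U ->
      outer_content g F <= inner_content g V < outer_content g F + e%:E.
  move=> stm_g e0.
  have [_ [U [oU FU] <-] Ue] := lb_ereal_inf_adherent e0 (stm_outer_content_fin_num stm_g F).
  exists U => // V oV FV VU; apply/andP; split.
    by apply: ereal_inf_lbound; exists V.
  exact: le_lt_trans (le_inner_content _ VU) Ue.
rewrite -(fineK (stm_outer_content_fin_num stm_f F)) -(fineK (stm_outer_content_fin_num stm_Nf F)) -EFinB; congr EFin.
apply/eqP; rewrite -subr_eq0 -normr_eq0 eq_le normr_ge0 andbT.
apply/ler_addgt0Pr => e e0; rewrite add0r.
(* Half of [e] is for [f]. The errors of the two contents both lie in [[0, e / 2)], so their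
   difference costs only the other half. *)
have e2 : (0 < e / 2)%R by rewrite divr_gt0.
have [U [oU FU] fU] := stm_closed_approx stm_f cF e2.
have [U1 [oU1 FU1] pU] := near _ _ stm_f e2.
have [U2 [oU2 FU2] nU] := near _ _ stm_Nf e2.
pose V := U `&` U1 `&` U2.
have oV : open V by apply: openI => //; exact: openI.
have FV : F `<=` V by rewrite !subsetI.
have := fU V oV FV (fun x Vx => Vx.1.1).
have := pU V oV FV (fun x Vx => Vx.1.2).
have := nU V oV FV (fun x Vx => Vx.2).
have := stm_jordan_open hausX stm_f oV.
rewrite -!outer_content_open//.
rewrite -(fineK (stm_outer_content_fin_num stm_f F)) -(fineK (stm_outer_content_fin_num stm_Nf F)).
rewrite -(fineK (stm_outer_content_fin_num stm_f V)) -(fineK (stm_outer_content_fin_num stm_Nf V)).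
rewrite -EFinB -!EFinD !lee_fin !lte_fin => -[->] /andP[? ?] /andP[? ?].
by rewrite ltr_norml ler_norml => /andP[? ?]; apply/andP; split; lra.
Qed.

End jordan.

(** * Reduction to bounded real values *)

Section reduction.
Context {R : realType} {X : topologicalType}.
Implicit Types nu : set X -> \bar R.

Lemma total_variation_ge nu K : compact K ->
  `|nu K| <= tm_total_variation nu setT.
Proof.
move=> cK; rewrite /tm_total_variation asboolT; last exact: openT.
apply: ereal_sup_ubound; exists 1%N, (fun=> K); split=> //; last by rewrite big_ord1.
by move=> i j _ _ _; rewrite (ord1 i) (ord1 j).
Qed.

Lemma bounded_stm_fine nu : hausdorff_space X ->
  tm_total_variation nu setT < +oo ->
  (forall A, open_or_closed A -> nu A \is a fin_num) ->
  disjoint_additive nu ->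
  (forall U, open U ->
    fine (nu K) @[K --> compacts_filter U] --> fine (nu U)) ->
  (forall F, closed F ->
    fine (nu U) @[U --> opens_filter F] --> fine (nu F)) ->
  bounded_stm (fine \o nu).
Proof.
move=> hausX TVoo nufin nuD nuI nuF.
have oc (A : set X) : compact_or_open A -> open_or_closed A.
  by move=> [cA|]; [right; exact: compact_closed|left].
split => //.
  by move=> A B cA cB cAB AB; rewrite /= nuD// fineD// nufin//; exact: oc.
have TVfin : tm_total_variation nu setT \is a fin_num.
  rewrite ge0_fin_numE//; apply: le_trans (total_variation_ge nu (@compact0 X)).
  exact: abse_ge0.
exists (fine (tm_total_variation nu setT)) => K cK.
have nuK : nu K \is a fin_num by apply: nufin; apply: oc; left.
have := total_variation_ge nu cK.
by rewrite -[X in `|X|]fineK// -[leRHS]fineK// lee_fin.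
Qed.

(** The total variation bounds [nu] on compact sets. The bound passes to open sets by inner limits,
    then to closed sets by outer limits, so all values are finite. *)
Lemma signed_bounded_stm nu : hausdorff_space X ->
  signed_topological_measure nu -> tm_total_variation nu setT < +oo ->
  (forall A, open_or_closed A -> nu A \is a fin_num) /\
  bounded_stm (fine \o nu).
Proof.
move=> hausX [_ nuD nuI nuF] TVoo.
have nuU U : open U -> `|nu U| <= tm_total_variation nu setT.
  move=> oU; apply: cvge_le (cvg_abse (nuI _ oU)).
  exists set0 => [|K [[cK _] _]]; first by split=> //; exact: compact0.
  exact: total_variation_ge.
have nuA A : open_or_closed A -> `|nu A| <= tm_total_variation nu setT.
  move=> [|cA]; first exact: nuU.
  apply: cvge_le (cvg_abse (nuF _ cA)).
  exists setT => [|U [[oU _] _]]; first by split=> //; exact: openT.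
  exact: nuU.
have fin A : open_or_closed A -> nu A \is a fin_num.
  by move=> /nuA ?; rewrite fin_num_abs; exact: le_lt_trans TVoo.
split=> //; apply: bounded_stm_fine => //.
- by move=> U oU; apply: fine_cvg; rewrite fineK ?fin//; [exact: nuI|left].
- by move=> F cF; apply: fine_cvg; rewrite fineK ?fin//; [exact: nuF|right].
Qed.

Lemma topological_measure_mono nu A B : topological_measure nu ->
  open_or_closed A -> open_or_closed B -> A `<=` B -> nu A <= nu B.
Proof.
case=> _ _ _ nuI nuF.
have nuAU U V : open_or_closed U -> open V -> U `<=` V -> nu U <= nu V.
  move=> [oU|cU] oV UV; last first.
    by rewrite (nuF _ cU); apply: ereal_inf_lbound; exists V.
  rewrite (nuI _ oU) (nuI _ oV); apply: ereal_sup_le => _ [K [cK KU] <-].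
  by exists K => //; split=> //; exact: subset_trans UV.
move=> oA [oB|cB] AB; first exact: nuAU.
rewrite (nuF _ cB); apply: le_ereal_inf_tmp => _ [V [oV BV] <-].
by apply: nuAU => //; exact: subset_trans BV.
Qed.

(** Inner regularity bounds [nu setT] by the total variation. Monotonicity and finiteness then turn
    the supremum and the infimum of the regularity conditions into limits. *)
Lemma topological_bounded_stm nu : hausdorff_space X ->
  topological_measure nu -> tm_total_variation nu setT < +oo ->
  (forall A, open_or_closed A -> nu A \is a fin_num) /\
  bounded_stm (fine \o nu).
Proof.
move=> hausX tm_nu TVoo; have [nu0 _ nuD nuI nuF] := tm_nu.
have mono := topological_measure_mono tm_nu.
have ocT : @open_or_closed X setT by left; exact: openT.
have oc (K : set X) : compact K -> open_or_closed K.
  by right; exact: compact_closed.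
have fin A : open_or_closed A -> nu A \is a fin_num.
  move=> ocA; rewrite ge0_fin_numE ?nu0//.
  apply: (le_lt_trans (mono _ _ ocA ocT (@subsetT _ _))).
  rewrite nuI; last exact: openT.
  apply: le_lt_trans TVoo; apply: ge_ereal_sup => _ [K [cK _] <-].
  exact: le_trans (lee_abs _) (total_variation_ge nu cK).
split=> //; apply: bounded_stm_fine => //.
- move=> U oU; have ocU : open_or_closed U by left.
  apply/cvgrPdist_lt => e e0; have := fin _ ocU; rewrite {1}(nuI _ oU).
  move=> /(ub_ereal_sup_adherent e0)[_ [K [cK KU] <-]].
  rewrite -nuI// => nuK; exists K => // K' [[cK' K'U] KK'].
  have := mono _ _ (oc _ cK') ocU K'U.
  have := mono _ _ (oc _ cK) (oc _ cK') KK'.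
  move: nuK; rewrite -(fineK (fin _ ocU)) -(fineK (fin _ (oc _ cK))).
  rewrite -(fineK (fin _ (oc _ cK'))) -EFinB lte_fin !lee_fin => ? ? ?.
  by rewrite /= ltr_norml; apply/andP; split; lra.
- move=> F cF; have ocF : open_or_closed F by right.
  apply/cvgrPdist_lt => e e0; have := fin _ ocF; rewrite {1}(nuF _ cF).
  move=> /(lb_ereal_inf_adherent e0)[_ [U [oU FU] <-]].
  rewrite -nuF// => nuU; exists U => // V [[oV FV] VU].
  have ocU : open_or_closed U by left.
  have ocV : open_or_closed V by left.
  have := mono _ _ ocF ocV FV; have := mono _ _ ocV ocU VU.
  move: nuU; rewrite -(fineK (fin _ ocF)) -(fineK (fin _ ocU)).
  rewrite -(fineK (fin _ ocV)) -EFinD lte_fin !lee_fin => ? ? ?.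
  by rewrite /= ltr_norml; apply/andP; split; lra.
Qed.

End reduction.

(** * Representation by Radon measures *)

Theorem theorem69 (R : realType) (X : topologicalType)
  (hausX : hausdorff_space X) (lcX : locally_compact [set: X])
  (dimX : covering_dim_le1 X) :
  (forall nu : set X -> \bar R,
     topological_measure nu -> tm_total_variation nu [set: X] < +oo ->
     exists m : set X -> \bar R, radon_measure m /\ is_restriction nu m) /\
  (forall nu : set X -> \bar R,
     signed_topological_measure nu -> tm_total_variation nu [set: X] < +oo ->
     exists m : set X -> \bar R, signed_radon_measure m /\ is_restriction nu m).
Proof.
split=> nu tm_nu TVoo.
  have [fin stm_f] := topological_bounded_stm hausX tm_nu TVoo.
  have [_ _ _ nuI nuF] := tm_nu.
  (* Inner regularity identifies [nu] with [p] on open sets; outer regularity then gives closed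
     sets, so a single Radon measure suffices. *)
  have nuU U : open U -> nu U = inner_content (fine \o nu) U.
    move=> oU; rewrite (nuI _ oU); congr ereal_sup; apply: eq_imagel => K [cK _].
    by rewrite /= fineK// fin//; right; exact: compact_closed.
  exists (outer_content (fine \o nu)); split.
    exact: stm_outer_content_radon.
  move=> A [oA|cA]; first by rewrite outer_content_open// nuU.
  rewrite (nuF _ cA); congr ereal_inf; apply: eq_imagel => U [oU _].
  exact: nuU.
have [fin stm_f] := signed_bounded_stm hausX tm_nu TVoo.
have stm_Nf := bounded_stmN stm_f.
set f := fine \o nu.
(* The two terms are the finite Radon measures induced by [p] and [n]. *)
exists (fun B => outer_content f B - outer_content (\- f)%R B); split.
  exists (outer_content f), (outer_content (\- f)%R); split=> //.
    split; first exact: stm_outer_content_radon.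
    by have := stm_outer_content_fin_num stm_f setT; rewrite fin_numElt => /andP[].
  split; first exact: stm_outer_content_radon.
  by have := stm_outer_content_fin_num stm_Nf setT; rewrite fin_numElt => /andP[].
move=> A ocA; rewrite -[nu A]fineK ?fin//; case: ocA => [oA|cA].
  by rewrite !outer_content_open//; exact: stm_jordan_open.
exact: stm_jordan_closed.
Qed.
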